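(* Let $\mathbf{X}\in\mathbb{R}^{n\times p}$ have columns of unit $\ell_2$ norm, let $\boldsymbol{\beta}\in\mathbb{R}^p$ have support $\mathcal{I}$ with $|\mathcal{I}|=k_0\ge1$, and suppose $(\mathbf{X},\boldsymbol{\beta})$ satisfies the exact recovery condition: $\mathbf{X}_{\mathcal{I}}$ has full column rank and $\max_{j\notin\mathcal{I}}\|\mathbf{X}_{\mathcal{I}}^{\dagger}\mathbf{X}_j\|_1<1$. Let $\mathbf{y}=\mathbf{X}\boldsymbol{\beta}+\mathbf{w}$ with $\mathbf{w}\sim\mathcal{N}(\mathbf{0}_n,\sigma^2\mathbf{I}_n)$, and let $\hat{\mathcal{I}}$ be the support estimate of TF-OMP with $k_{max}>k_0$. Then TF-OMP is high SNR consistent: $\lim_{\sigma^2\to0}\mathbb{P}(\hat{\mathcal{I}}\neq\mathcal{I})=0$.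
   Context: Notation: $\mathbf{X}_{\mathcal{J}}$ is the submatrix of columns indexed by $\mathcal{J}$; $\mathbf{A}^{\dagger}=(\mathbf{A}^T\mathbf{A})^{-1}\mathbf{A}^T$ for full column rank $\mathbf{A}$; $\mathbf{P}_{\mathcal{J}}=\mathbf{X}_{\mathcal{J}}\mathbf{X}_{\mathcal{J}}^{\dagger}$. Orthogonal matching pursuit (OMP): set $\mathbf{r}^{(0)}=\mathbf{y}$, $\mathcal{J}^0=\emptyset$; at iteration $k\ge1$ select $t_k=\arg\max_{t\in\{1,\dots,p\}}|\mathbf{X}_t^T\mathbf{r}^{(k-1)}|$, set $\mathcal{J}^k=\mathcal{J}^{k-1}\cup\{t_k\}$ and $\mathbf{r}^{(k)}=(\mathbf{I}_n-\mathbf{P}_{\mathcal{J}^k})\mathbf{y}$. TF-OMP (tuning free OMP): run OMP for $k_{max}$ iterations (it is assumed that along these iterations the matrices $\mathbf{X}_{\mathcal{J}^k}$ have full column rank and the residuals $\mathbf{r}^{(k)}$ are nonzero); compute $t(k)=\|\mathbf{r}^{(k)}\|_2^2/\|\mathbf{r}^{(k-1)}\|_2^2$; let $k^*=\arg\min_{1\le k\le k_{max}-1}t(k)$; output the support estimate $\hat{\mathcal{I}}=\{t_1,\dots,t_{k^*}\}$. *)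

(* Defs.v *)
From HB Require Import structures.
From mathcomp Require Import all_boot all_order all_algebra.
From mathcomp Require Import all_classical all_reals all_analysis.
Set Implicit Arguments. Unset Strict Implicit. Unset Printing Implicit Defensive.
Import Order.TTheory GRing.Theory Num.Theory.
Local Open Scope ring_scope.

Section OMP.
Variable R : realType.
Variables (n p : nat).
Implicit Types (X : 'M[R]_(n, p)) (y : 'cV[R]_n).

Definition subcols X (J : seq 'I_p) : 'M[R]_(n, size J) :=
  colsub (fun j : 'I_(size J) => tnth (in_tuple J) j) X.

Definition pinv m (A : 'M[R]_(n, m)) : 'M[R]_(m, n) := invmx (A^T *m A) *m A^T.

Definition projJ X (J : seq 'I_p) : 'M[R]_n := subcols X J *m pinv (subcols X J).

Definition resid X y (J : seq 'I_p) : 'cV[R]_n := y - projJ X J *m y.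

Definition sqnorm (v : 'cV[R]_n) : R := \sum_i v i 0 ^+ 2.

(* one OMP step: t_k = argmax_t |X_t^T r^(k-1)| (ties broken by the library's
   arg max choice) *)
Definition omp_step X y (J : seq 'I_p) : seq 'I_p :=
  match [pick t : 'I_p] with
  | None => J
  | Some t0 =>
      rcons J (Order.arg_max t0 xpredT
        (fun t : 'I_p => `|((col t X)^T *m resid X y J) 0 0|))
  end.

Fixpoint omp X y (k : nat) : seq 'I_p :=
  if k is k'.+1 then omp_step X (y) (omp X y k') else [::].

Definition omp_resid X y k : 'cV[R]_n := resid X y (omp X y k).

Definition tf_ratio X y k : R :=
  sqnorm (omp_resid X y k) / sqnorm (omp_resid X y k.-1).

Definition tf_kstar X y (kmax : nat) : nat :=
  match [pick i : 'I_kmax.-1] with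
  | None => 0
  | Some i0 => (val (Order.arg_min i0 xpredT
                    (fun i : 'I_kmax.-1 => tf_ratio X y (val i).+1))).+1
  end.

Definition tf_omp X y (kmax : nat) : {set 'I_p} :=
  [set t in take (tf_kstar X y kmax) (omp X y kmax)].

(* the standing assumption of TF-OMP along the kmax iterations:
   X_{J^k} has full column rank and r^(k) != 0, for 1 <= k <= kmax *)
Definition tf_omp_welldef X y (kmax : nat) : bool :=
  [forall k : 'I_kmax,
     (\rank (subcols X (omp X y k.+1)) == size (omp X y k.+1))
     && (omp_resid X y k.+1 != 0)].

Definition supp (beta : 'cV[R]_p) : {set 'I_p} := [set j | beta j 0 != 0].

Definition subcolsS X (I : {set 'I_p}) := subcols X (enum I).

Definition ERC X (I : {set 'I_p}) : Prop :=
  \rank (subcolsS X I) = size (enum I) /\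
  forall j : 'I_p, j \notin I ->
    \sum_i `|(pinv (subcolsS X I) *m col j X) i 0| < 1.

End OMP.

(* Expectation (integral) of a function of a vector w with i.i.d. N(0, s^2)
   coordinates, as the iterated integral over the product of n copies of the
   one-dimensional normal law normal_prob 0 s. *)
Fixpoint gauss_int (R : realType) (s : R) (n : nat) :
    (('I_n -> R) -> \bar R) -> \bar R :=
  match n with
  | 0 => fun f => f (fun _ => 0)
  | n'.+1 => fun f =>
      (\int[normal_prob 0 s]_x
         gauss_int s (fun z : 'I_n' -> R =>
           f (fun i : 'I_n'.+1 =>
                if unlift ord0 i is Some j then z j else x)))%E
  end.

Definition gauss_prob (R : realType) (n : nat) (s : R) (E : 'cV[R]_n -> bool)
  : \bar R :=
  gauss_int s (fun z : 'I_n -> R => ((E (\col_i z i))%:R)%:E).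

(* Main.v *)
(** For small noise w, the exact recovery condition forces the first k0
    selections of OMP to be the support I, with residuals bounded away from 0
    before step k0; so t(k) is bounded below for k < k0 while t(k0) = O(|w|^2).
    After step k0 the residual is (I - P_J) w with J containing I, hence
    |r^(k)| <= |w|, and |r^(k)| >= |u_J . w| where u_J = (I - P_J) X_t is nonzero
    for some t, because the standing assumption gives rank X >= kmax.  Thus
    t(k) > delta for k > k0 unless |u_J . w|^2 <= delta |w|^2 for one of finitely
    many J.  That exceptional event is covered by |w_i| >= K sigma and
    |u_J . w| <= a sigma, whose probabilities are at most 2 exp(-3K^2/8) and C a
    uniformly in sigma.  Choosing K, then a, then sigma proves the claim. *)
Require Import Defs.
From HB Require Import structures.
From mathcomp Require Import all_boot all_order all_algebra.
From mathcomp Require Import all_classical all_reals all_analysis.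
From mathcomp Require Import measurable_realfun ring lra.
Import Order.TTheory GRing.Theory Num.Theory.
Local Open Scope ring_scope.
Local Open Scope classical_set_scope.
Import numFieldNormedType.Exports.

(** The integral of a nonnegative function, measurable or not, is a supremum over the simple
    functions below it. This serves iterated integrals whose inner integrals carry no measurability
    information. *)
Lemma ge0_le_integralT d (T : measurableType d) (R : realType)
    (mu : {measure set T -> \bar R}) (f g : T -> \bar R) :
  (forall x, 0 <= f x)%E -> (forall x, f x <= g x)%E ->
  (\int[mu]_x f x <= \int[mu]_x g x)%E.
Proof.
move=> f0 fg; rewrite !ge0_integralTE//; last first.
  by move=> x; exact: le_trans (fg x).
apply: ereal_sup_le => _ [h hf <-]; exists h => // x.
exact: le_trans (hf x) (fg x).
Qed.

(** * Small-ball and tail bounds for the one-dimensional normal law *)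

Section normal_bounds.
Context {R : realType}.
Implicit Types (s K a b q : R).
Local Notation mu := lebesgue_measure.

Lemma normal_peakE s : 0 < s -> normal_peak s = s^-1 * normal_peak 1.
Proof.
move=> s0; rewrite /normal_peak -mulrnAr sqrtrM ?sqr_ge0// sqrtr_sqr gtr0_norm//.
by rewrite invfM expr1n mul1r.
Qed.

Lemma normal_prob_le_lebesgue s (A : set R) : s != 0 -> measurable A ->
  (normal_prob 0 s A <= (normal_peak s)%:E * mu A)%E.
Proof.
move=> s0 mA; rewrite /normal_prob -integral_cst//.
apply: ge0_le_integral => //=.
- by move=> x _; rewrite lee_fin normal_pdf_ge0.
- by apply/measurable_EFinP/measurable_funTS; exact: measurable_normal_pdf.
- by move=> x _; rewrite lee_fin normal_pdf_ub.
Qed.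

Lemma measurable_affine_norm_le q b a :
  measurable [set x : R | `|q + b * x| <= a].
Proof.
have -> : [set x : R | `|q + b * x| <= a] =
    (fun x => `|q + b * x|) @^-1` `]-oo, a].
  by apply/seteqP; split => x /=; rewrite in_itv.
have mf : measurable_fun setT (fun x => `|q + b * x|).
  apply: measurableT_comp => //; apply: measurable_funD => //.
by rewrite -[X in measurable X]setTI; exact: mf.
Qed.

Lemma measurable_le_norm K : measurable [set x : R | K <= `|x|].
Proof.
have -> : [set x : R | K <= `|x|] = Num.norm @^-1` `[K, +oo[.
  by apply/seteqP; split => x /=; rewrite in_itv/= andbT.
have mf : measurable_fun setT (@Num.norm R R) by [].
by rewrite -[X in measurable X]setTI; exact: mf.
Qed.

(** The event lies in an interval of length 2as/|b|, and the density is at most [normal_peak 1] / s.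
    The factors s cancel, so the bound is uniform in the noise level. *)
Lemma normal_prob_affine s a q b : 0 < s -> 0 <= a -> b != 0 ->
  (normal_prob 0 s [set x | (`|q + b * x| <= a * s)%R]
    <= (2 * normal_peak 1 / `|b| * a)%:E)%E.
Proof.
move=> s0 a0 b0.
have nb0 : 0 < `|b| by rewrite normr_gt0.
set A := [set x | _].
apply: (le_trans (normal_prob_le_lebesgue s A _ _)).
- by rewrite gt_eqF.
- exact: measurable_affine_norm_le.
have AE : A `<=` `[- q / b - a * s / `|b|, - q / b + a * s / `|b|]%classic.
  move=> x; rewrite /A/= => Ax; rewrite in_itv/= -lter_distl.
  rewrite -(ler_pM2r nb0) -normrM mulfVK ?gt_eqF//.
  by rewrite mulrBl mulfVK// opprK addrC mulrC.
have mA : (mu A <= (2 * (a * s / `|b|))%:E)%E.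
  apply: (@le_trans _ _ (mu `[- q / b - a * s / `|b|, - q / b + a * s / `|b|]%classic)).
    apply: (le_measure lebesgue_measure); rewrite ?inE;
      [exact: measurable_affine_norm_le| |exact: AE].
    exact: measurable_itv.
  rewrite lebesgue_measure_itv/=; case: ifP => _.
    by rewrite -EFinB lee_fin; lra.
  by rewrite lee_fin !mulr_ge0 ?invr_ge0// ltW.
apply: (le_trans (lee_wpmul2l _ mA)); first by rewrite lee_fin normal_peak_ge0.
rewrite -EFinM lee_fin normal_peakE//.
rewrite le_eqVlt; apply/orP; left; apply/eqP; field.
by rewrite gt_eqF//= gt_eqF.
Qed.

(* Writing x^2/2s^2 = x^2/8s^2 + 3x^2/8s^2 compares the tail with the density
   of standard deviation 2s. *)
Lemma normal_prob_tail s K : 0 < s -> 0 <= K ->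
  (normal_prob 0 s [set x | (K * s <= `|x|)%R]
    <= (2 * expR (- (3 * K ^+ 2 / 8)))%:E)%E.
Proof.
move=> s0 K0.
have s20 : 2 * s != 0 by rewrite mulf_neq0// gt_eqF.
have mA : measurable [set x : R | K * s <= `|x|].
  exact: measurable_le_norm.
pose c := 2 * expR (- (3 * K ^+ 2 / 8)).
have c0 : 0 <= c by rewrite mulr_ge0// expR_ge0.
apply: (@le_trans _ _ (\int[mu]_(x in [set x | (K * s <= `|x|)%R])
    (c%:E * (normal_pdf 0 (2 * s) x)%:E))%E).
  apply: ge0_le_integral => //=.
  - by move=> x _; rewrite lee_fin normal_pdf_ge0.
  - by apply/measurable_EFinP/measurable_funTS; exact: measurable_normal_pdf.
  - apply/measurable_EFinP/measurable_funTS; apply: measurable_funM => //.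
    exact: measurable_normal_pdf.
  move=> x xA; rewrite -EFinM lee_fin !normal_pdfE ?gt_eqF// ?mulr_gt0//.
  rewrite (normal_peakE s)// (normal_peakE (2 * s)) ?mulr_gt0// /normal_fun !subr0.
  have -> : c * ((2 * s)^-1 * normal_peak 1 *
      expR (- x ^+ 2 / ((2 * s) ^+ 2 *+ 2))) = s^-1 * normal_peak 1 *
      (expR (- (3 * K ^+ 2 / 8)) * expR (- x ^+ 2 / ((2 * s) ^+ 2 *+ 2))).
    by rewrite /c; field; rewrite gt_eqF.
  rewrite ler_pM2l; last first.
    by apply: mulr_gt0; [rewrite invr_gt0|apply: normal_peak_gt0; rewrite oner_eq0].
  rewrite -expRD ler_expR.
  have -> : - x ^+ 2 / (s ^+ 2 *+ 2) = - (3 * (x ^+ 2 / s ^+ 2) / 8)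
      + - x ^+ 2 / ((2 * s) ^+ 2 *+ 2).
    by field; rewrite gt_eqF.
  rewrite lerD2r lerN2 ler_pM2r// ler_pM2l// ler_pdivlMr ?exprn_gt0//.
  by rewrite -exprMn -[leRHS]real_normK ?num_real// lerXn2r ?nnegrE ?mulr_ge0// ltW.
rewrite ge0_integralZl//=; last first.
- by move=> x _; rewrite lee_fin normal_pdf_ge0.
- by apply/measurable_EFinP/measurable_funTS; exact: measurable_normal_pdf.
rewrite -[leRHS]mule1; apply: lee_wpmul2l; first by rewrite lee_fin.
rewrite -[X in (X <= _)%E]/(normal_prob 0 (2 * s) _).
exact: probability_le1.
Qed.

End normal_bounds.

(** * Iterated Gaussian integrals and a union bound for linear forms *)

Section gauss_int_theory.
Context {R : realType}.
Implicit Types (s : R) (n : nat).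

Lemma eq_gauss_int s n (f g : ('I_n -> R) -> \bar R) :
  f =1 g -> gauss_int s f = gauss_int s g.
Proof. by move=> /funext->. Qed.

Lemma gauss_int_ge0 s n (f : ('I_n -> R) -> \bar R) :
  (forall z, 0 <= f z)%E -> (0 <= gauss_int s f)%E.
Proof.
elim: n f => [|n IH] f f0 /=; first exact: f0.
by apply: integral_ge0 => x _; apply: IH => z.
Qed.

Lemma le_gauss_int s n (f g : ('I_n -> R) -> \bar R) :
  (forall z, 0 <= f z)%E -> (forall z, f z <= g z)%E ->
  (gauss_int s f <= gauss_int s g)%E.
Proof.
elim: n f g => [|n IH] f g f0 fg /=; first exact: fg.
apply: ge0_le_integralT => x; first by apply: gauss_int_ge0 => z.
by apply: IH => z.
Qed.

Lemma gauss_int_cst s n (c : \bar R) : gauss_int s (fun _ : 'I_n -> R => c) = c.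
Proof.
elim: n => [//|n IH] /=; under eq_integral do rewrite IH.
rewrite integral_cst// [X in (_ * X)%E](probability_setT (normal_prob 0 s)) mule1//.
Qed.

Lemma gauss_int_bool_le1 s n (E : ('I_n -> R) -> bool) :
  (gauss_int s (fun z => (E z)%:R%:E) <= 1)%E.
Proof.
rewrite -(gauss_int_cst s n 1%E); apply: le_gauss_int => z; rewrite lee_fin//.
by case: (E _).
Qed.

(** An event containing every vector has probability 1. This extracts one concrete noise vector from
    an almost sure assumption. *)
Lemma gauss_prob_eq0_ex s n (E : 'cV[R]_n -> bool) :
  gauss_prob s E = 0%E -> exists w, ~~ E w.
Proof.
move=> E0; apply/not_existsP => nE.
suff : gauss_prob s E = 1%E by rewrite E0 => /eqP; rewrite eqe eq_sym oner_eq0.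
rewrite -(gauss_int_cst s n 1%E); apply: eq_gauss_int => z.
by have /negP/negPn-> := nE (\col_i z i).
Qed.

(* Each linear form is integrated out along its last nonzero coordinate, which
   makes the union bound hold without any joint measurability. *)
Lemma gauss_int_small_or_large n (I : finType) (P : pred I) (L : I -> 'I_n -> R) :
  (forall l, P l -> exists i, L l i != 0) ->
  exists2 C : R, 0 <= C & forall (s a K : R) (q : I -> R),
    0 < s -> 0 <= a -> 0 <= K ->
    (gauss_int s (fun z =>
       ([exists l, P l && (`|q l + \sum_i L l i * z i| <= a * s)%R]
       || [exists i, K * s <= `|z i|]%R)%:R%:E)
     <= (C * a + n%:R * (2 * expR (- (3 * K ^+ 2 / 8))))%:E)%E.
Proof.
elim: n P L => [|n IH] P L LP.
  exists 0 => // s a K q s0 a0 K0 /=; rewrite !mul0r addr0.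
  rewrite (_ : _ || _ = false)//.
  apply/negbTE; rewrite negb_or; apply/andP; split.
    by apply/existsPn => l; apply/negP => /andP[/LP[[]]].
  by apply/existsPn => -[].
(* Forms in [P1] involve a later coordinate and go to the induction hypothesis, with the first
   coordinate absorbed into the offset [q]. Forms in [P2] depend on the first coordinate alone. *)
pose P1 l := P l && [exists i, L l (lift ord0 i) != 0].
pose P2 l := P l && ~~ [exists i, L l (lift ord0 i) != 0].
have [|C C0 HC] := IH P1 (fun l i => L l (lift ord0 i)).
  by move=> l /andP[_ /existsP].
have P2L l : P2 l -> L l ord0 != 0 /\ forall i, L l (lift ord0 i) = 0.
  move=> /andP[Pl /existsPn nL]; split; last first.
    by move=> i; have /negPn/eqP := nL i.
  have [i] := LP _ Pl; case: (unliftP ord0 i) => [j ->|->//].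
  by rewrite (negbTE (nL j)).
pose r := [seq l <- index_enum I | P2 l].
pose c := \sum_(l <- r) (2 * normal_peak 1 / `|L l ord0|).
have c0 : 0 <= c.
  by apply: sumr_ge0 => l _; rewrite !mulr_ge0 ?invr_ge0// normal_peak_ge0.
exists (c + C); first by rewrite addr_ge0.
move=> s a K q s0 a0 K0 /=.
pose tail := [set x : R | K * s <= `|x|].
pose A l := [set x : R | `|q l + L l ord0 * x| <= a * s].
pose B := C * a + n%:R * (2 * expR (- (3 * K ^+ 2 / 8))).
have B0 : 0 <= B by rewrite addr_ge0 ?mulr_ge0// expR_ge0.
have mtail : measurable tail by exact: measurable_le_norm.
have mA l : measurable (A l) by exact: measurable_affine_norm_le.
have mI l : measurable_fun setT (fun x : R => (\1_(A l) x)%:E).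
  by apply/measurable_EFinP; exact: measurable_indic.
(* A measurable majorant of the inner integral: its own integral can be split term by term. *)
pose g (x : R) : \bar R := ((\1_tail x)%:E + (\sum_(l <- r) (\1_(A l) x)%:E + B%:E))%E.
apply: (@le_trans _ _ (\int[normal_prob 0 s]_x g x)%E); last first.
  rewrite /g.
  rewrite ge0_integralD//=; last 3 first.
  - exact/measurable_EFinP/measurable_indic.
  - by move=> x _; rewrite adde_ge0 ?lee_fin// sume_ge0// => l _; rewrite lee_fin.
  - apply: emeasurable_funD => //; apply: emeasurable_sum => l.
    exact: mI.
  rewrite ge0_integralD//=; last 2 first.
  - by move=> x _; rewrite sume_ge0// => l _; rewrite lee_fin.
  - by apply: emeasurable_sum => l; exact: mI.
  rewrite ge0_integral_sum//; last by move=> l; exact: mI.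
  rewrite integral_cst// [X in (_ * X)%E](probability_setT (normal_prob 0 s)) mule1.
  rewrite integral_indic// setIT.
  have -> : ((c + C) * a + n.+1%:R * (2 * expR (- (3 * K ^+ 2 / 8))))%:E
      = ((2 * expR (- (3 * K ^+ 2 / 8)))%:E + ((c * a)%:E + B%:E))%E.
    by rewrite -!EFinD; congr EFin; rewrite /B -natr1; ring.
  apply: leeD; first exact: normal_prob_tail.
  apply: leeD => //; rewrite /c mulr_suml -sumEFin big_seq [leRHS]big_seq.
  apply: lee_sum => l; rewrite mem_filter => /andP[/P2L[Ll _] _].
  rewrite integral_indic//; last exact: mA.
  by rewrite setIT; exact: normal_prob_affine.
apply: ge0_le_integralT => x.
  by apply: gauss_int_ge0 => z; rewrite lee_fin.
rewrite /g; set S : \bar R := (\sum_(l <- r) _)%E.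
have sum0 : (0 <= S)%E.
  by rewrite sume_ge0// => l _; rewrite lee_fin.
(* On [tail] or on some [A l] the majorant is at least 1. Elsewhere no [P2] form is small, whatever
   the remaining coordinates, and the induction hypothesis bounds the rest by [B]. *)
have [xt|xt] := pselect (tail x).
  apply: (@le_trans _ _ 1%E); first exact: gauss_int_bool_le1.
  by rewrite indicE mem_set// leeDl// adde_ge0// lee_fin.
have [[l [lr xl]]|nl] := pselect (exists l, l \in r /\ A l x).
  apply: (@le_trans _ _ 1%E); first exact: gauss_int_bool_le1.
  apply: (@le_trans _ _ S); last first.
    by rewrite addeCA leeDl// adde_ge0// lee_fin.
  by rewrite /S (big_rem l)//= indicE mem_set// leeDl// sume_ge0//.
apply: (@le_trans _ _ B%:E); last first.
  by rewrite addeA leeDr// adde_ge0// lee_fin.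
apply: le_trans (HC s a K (fun l => q l + L l ord0 * x) s0 a0 K0).
apply: le_gauss_int => z; rewrite lee_fin// ler_nat.
case: (boolP (_ || _)) => // bad; rewrite lt0b; move: bad => /orP[/existsP[l /andP[Pl]]|/existsP[i]].
  rewrite big_ord_recl unlift_none => Hl.
  apply/orP; left; apply/existsP; exists l.
  have e : \sum_(i < n) L l (lift ord0 i) * match unlift ord0 (lift ord0 i) with
     | Some j => z j | None => x end = \sum_(i < n) L l (lift ord0 i) * z i.
    by apply: eq_bigr => i _; rewrite liftK.
  rewrite e addrA in Hl.
  rewrite Hl andbT /P1 Pl/=; apply: contraT => nl0; exfalso; apply: nl; exists l.
  have P2l : P2 l by rewrite /P2 Pl.
  split; first by rewrite mem_filter P2l mem_index_enum.
  have [_ l0] := P2L _ P2l.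
  move: Hl; rewrite big1 ?addr0// => i _; by rewrite l0 mul0r.
case: (unliftP ord0 i) => [j _ Hj|_ /xt//].
by apply/orP; right; apply/existsP; exists j.
Qed.

End gauss_int_theory.

(** * Euclidean inner product *)

Section dotc.
Context {R : realType} {n : nat}.
Implicit Types u v w : 'cV[R]_n.

Definition dotc u v : R := (u^T *m v) 0 0.

Lemma dotcE u v : dotc u v = \sum_i u i 0 * v i 0.
Proof. by rewrite /dotc mxE; apply: eq_bigr => i _; rewrite mxE. Qed.

Lemma dotcC u v : dotc u v = dotc v u.
Proof. by rewrite !dotcE; apply: eq_bigr => i _; rewrite mulrC. Qed.

Lemma dotcDr u v w : dotc u (v + w) = dotc u v + dotc u w.
Proof. by rewrite /dotc mulmxDr mxE. Qed.

Lemma dotcZr u a v : dotc u (a *: v) = a * dotc u v.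
Proof. by rewrite /dotc -scalemxAr mxE. Qed.

Lemma dotc0 u : dotc u 0 = 0.
Proof. by rewrite /dotc mulmx0 mxE. Qed.

Lemma sqnormE v : sqnorm v = dotc v v.
Proof. by rewrite dotcE; apply: eq_bigr. Qed.

Lemma sqnorm_ge0 v : 0 <= sqnorm v.
Proof. by apply: sumr_ge0 => i _; exact: sqr_ge0. Qed.

Lemma sqnorm_eq0 v : (sqnorm v == 0) = (v == 0).
Proof.
apply/eqP/eqP => [v0|->]; last by rewrite /sqnorm big1// => i _; rewrite mxE expr0n.
apply/matrixP => i j; rewrite ord1 mxE; apply/eqP; rewrite -sqrf_eq0; apply/eqP.
by move/psumr_eq0P: v0 => ->// k _; exact: sqr_ge0.
Qed.

Lemma sqnormD u v : sqnorm (u + v) = sqnorm u + 2 * dotc u v + sqnorm v.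
Proof. by rewrite !sqnormE dotcDr ![dotc (u + v) _]dotcC !dotcDr (dotcC v u); ring. Qed.

Lemma sqnormD_le u v : sqnorm (u + v) <= 2 * sqnorm u + 2 * sqnorm v.
Proof.
rewrite /sqnorm !mulr_sumr -big_split/=; apply: ler_sum => i _; rewrite mxE.
by have := sqr_ge0 (u i 0 - v i 0); nra.
Qed.

(** Cauchy-Schwarz for a unit vector, from expanding |v - (u . v) u|^2 >= 0. *)
Lemma dotc_unit_le u v : sqnorm u = 1 -> dotc u v ^+ 2 <= sqnorm v.
Proof.
move=> u1; have := sqnorm_ge0 (v + - dotc u v *: u).
rewrite sqnormD (sqnormE (_ *: _)) !dotcZr (dotcC (_ *: _)) dotcZr -sqnormE u1.
by rewrite (dotcC v u); nra.
Qed.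

End dotc.

(* The bare name is shadowed by the partial inverse of functions.v. *)
Local Notation pinv := Defs.pinv.

(** * Gram matrices and pseudo-inverses in full column rank *)

Section gram.
Context {R : realType} {n m : nat}.
Variable A : 'M[R]_(n, m).
Hypothesis fullA : \rank A = m.

Lemma gram_unit : A^T *m A \in unitmx.
Proof.
rewrite -row_free_unit; apply: inj_row_free => v vAA0.
have : sqnorm (A *m v^T) = 0.
  by rewrite sqnormE /dotc trmx_mul trmxK -mulmxA (mulmxA A^T) mulmxA vAA0 mul0mx mxE.
move/eqP; rewrite sqnorm_eq0 => /eqP Av0.
have : v *m A^T = 0 by rewrite -[v]trmxK -trmx_mul Av0 trmx0.
rewrite -(mul0mx _ A^T); apply: row_free_inj.
by rewrite /row_free mxrank_tr fullA.
Qed.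

Lemma pinvK : pinv A *m A = 1%:M.
Proof. by rewrite /pinv -mulmxA mulVmx// gram_unit. Qed.

Lemma proj_sym : (A *m pinv A)^T = A *m pinv A.
Proof.
by rewrite /pinv !trmx_mul trmxK trmx_inv trmx_mul trmxK mulmxA.
Qed.

End gram.

(** * Column spans, ranks and residuals *)

Section residuals.
Context {R : realType} {n p : nat}.
Variable X : 'M[R]_(n, p).
Implicit Types (J K : seq 'I_p) (t : 'I_p) (y v : 'cV[R]_n).

Definition full_rank J := \rank (subcols X J) == size J.

(** Matrix spaces are row spaces, hence the transposes. As a sum over [J], the span ignores the
    order of the columns and splits along concatenations. *)
Definition rowspan J : 'M[R]_n := (\sum_(t <- J) <<(col t X)^T>>)%MS.

Lemma submx_subcolsP J y : (y^T <= (subcols X J)^T)%MS <-> exists c, y = subcols X J *m c.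
Proof.
split=> [/submxP[D e]|[c ->]].
  by exists D^T; rewrite -[y]trmxK e trmx_mul trmxK.
by rewrite trmx_mul submxMl.
Qed.

Lemma col_subcols J i : col i (subcols X J) = col (tnth (in_tuple J) i) X.
Proof. by apply/colP => k; rewrite !mxE. Qed.

Lemma rowspan_mem J t : t \in J -> ((col t X)^T <= rowspan J)%MS.
Proof.
elim: J => // a J IH; rewrite inE /rowspan big_cons => /orP[/eqP ->|/IH tJ].
  by apply: submx_trans (addsmxSl _ _); rewrite genmxE.
exact: submx_trans tJ (addsmxSr _ _).
Qed.

Lemma eqmx_rowspan J : ((subcols X J)^T :=: rowspan J)%MS.
Proof.
apply/eqmxP/andP; split.
  apply/row_subP => i; rewrite -tr_col col_subcols.
  by apply: rowspan_mem; exact: mem_tnth.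
rewrite /rowspan big_seq; elim/big_ind: _ => [||t tJ]; first exact: sub0mx.
  by move=> x y Hx Hy; rewrite addsmx_sub Hx.
rewrite genmxE; have /tnthP[i ->] : t \in in_tuple J by [].
by rewrite -col_subcols tr_col row_sub.
Qed.

Lemma rank_rowspan J : \rank (rowspan J) = \rank (subcols X J).
Proof. by rewrite -eqmx_rowspan mxrank_tr. Qed.

Lemma rank_rowspan_le J : (\rank (rowspan J) <= size J)%N.
Proof. by rewrite rank_rowspan rank_leq_col. Qed.

Lemma full_rank_perm J K : perm_eq J K -> full_rank J = full_rank K.
Proof.
move=> JK; rewrite /full_rank -!rank_rowspan (perm_size JK) /rowspan.
by rewrite (perm_big _ JK).
Qed.

Lemma full_rank_catl J K : full_rank (J ++ K) -> full_rank J.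
Proof.
rewrite /full_rank -!rank_rowspan {1}/rowspan big_cat/= -!/(rowspan _) size_cat => /eqP e.
rewrite eqn_leq rank_rowspan_le/=.
have := (mxrank_adds_leqif (rowspan J) (rowspan K)).1; rewrite e => H.
by rewrite -(leq_add2r (size K)); apply: (leq_trans H); rewrite leq_add2l rank_rowspan_le.
Qed.

(** Since [J] has no repetitions, [K] is a permutation of [J] followed by further columns, and a
    prefix of an independent family is independent. *)
Lemma full_rank_subset J K : uniq J -> {subset J <= K} -> full_rank K -> full_rank J.
Proof.
move=> uJ JK fK; have [K' pK] : exists K', perm_eq K (J ++ K').
  have /count_subseqP[s sK pJs] : forall x, (count_mem x J <= count_mem x K)%N.
    move=> x; rewrite count_uniq_mem//; case: (boolP (x \in J)) => //= /JK.
    by rewrite -has_pred1 has_count.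
  have [K' pK] := perm_to_subseq sK; exists K'.
  by apply: (perm_trans pK); rewrite perm_cat2r perm_sym.
by apply: (@full_rank_catl J K'); rewrite -(full_rank_perm _ _ pK).
Qed.

Lemma residE y J : resid X y J = (1%:M - projJ X J) *m y.
Proof. by rewrite /resid mulmxBl mul1mx. Qed.

Lemma residD y v J : resid X (y + v) J = resid X y J + resid X v J.
Proof. by rewrite !residE mulmxDr. Qed.

Section full.
Variable J : seq 'I_p.
Hypothesis fJ : full_rank J.

Lemma resid_subcols (c : 'cV[R]_(size J)) : resid X (subcols X J *m c) J = 0.
Proof.
by rewrite /resid /projJ -mulmxA (mulmxA (pinv _)) pinvK ?mul1mx ?subrr//; exact/eqP.
Qed.

Lemma resid_eq0P y : resid X y J = 0 <-> (y^T <= rowspan J)%MS.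
Proof.
rewrite -(eqmx_rowspan J) submx_subcolsP; split=> [/eqP|[c ->]].
  rewrite subr_eq0 => /eqP e; exists (pinv (subcols X J) *m y).
  by rewrite mulmxA.
exact: resid_subcols.
Qed.

Lemma resid_mem t : t \in J -> resid X (col t X) J = 0.
Proof. by move=> tJ; apply/resid_eq0P; exact: rowspan_mem. Qed.

Lemma dotc_residC u v : dotc u (resid X v J) = dotc (resid X u J) v.
Proof.
rewrite /dotc !residE trmx_mul linearB/= trmx1 [(projJ X J)^T]proj_sym mulmxA.
by []. Qed.

(** Pythagoras: the residual is orthogonal to the projection, whose own residual vanishes. *)
Lemma sqnorm_resid_le y : sqnorm (resid X y J) <= sqnorm y.
Proof.
have e : y = resid X y J + projJ X J *m y by rewrite /resid subrK.
rewrite [X in _ <= sqnorm X]e sqnormD dotcC dotc_residC.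
have -> : resid X (projJ X J *m y) J = 0.
  by rewrite /projJ -!mulmxA resid_subcols.
by rewrite dotcC dotc0 mulr0 addr0 lerDl sqnorm_ge0.
Qed.

Lemma dotc_resid_mem t y : t \in J -> dotc (col t X) (resid X y J) = 0.
Proof. by move=> tJ; rewrite dotc_residC resid_mem// dotcC dotc0. Qed.

(** Appending a column raises the rank by at most one, and by exactly one when the column leaves the
    span of [J]. *)
Lemma full_rank_rcons t : full_rank (rcons J t) <-> resid X (col t X) J <> 0.
Proof.
rewrite resid_eq0P /full_rank -rank_rowspan size_rcons /rowspan.
rewrite -cats1 big_cat big_seq1/= -/(rowspan J).
have rJ : \rank (rowspan J) = size J by rewrite rank_rowspan; exact/eqP.
split=> [/eqP e tJ|/negP tJ].
  have : (rowspan J + <<(col t X)^T>> <= rowspan J)%MS.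
    by rewrite addsmx_sub submx_refl genmxE.
  by move/mxrankS; rewrite e rJ ltnn.
apply/eqP/anti_leq/andP; split.
  have := (mxrank_adds_leqif (rowspan J) <<(col t X)^T>>%MS).1.
  move/leq_trans; apply; rewrite rJ -(addn1 (size J)) leq_add2l genmxE mxrank_tr.
  exact: rank_leq_col.
rewrite -rJ; apply: rank_ltmx; rewrite ltmxE addsmxSl/=.
by apply: contra tJ => /(submx_trans (addsmxSr _ _)); rewrite genmxE.
Qed.

Lemma resid_projJ K y : {subset K <= J} -> resid X (projJ X K *m y) J = 0.
Proof.
move=> KJ; apply/resid_eq0P; rewrite /projJ -mulmxA trmx_mul.
apply: (submx_trans (submxMl _ _)); rewrite eqmx_rowspan /rowspan big_seq.
elim/big_ind: _ => [||t tK]; first exact: sub0mx.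
  by move=> A B HA HB; rewrite addsmx_sub HA.
by rewrite genmxE; apply: rowspan_mem; exact: KJ.
Qed.

Lemma mulmx_sum_colE (beta : 'cV[R]_p) : X *m beta = \sum_j beta j 0 *: col j X.
Proof.
apply/colP => i; rewrite mxE summxE; apply: eq_bigr => j _.
by rewrite !mxE mulrC.
Qed.

Lemma resid_mulmx (beta : 'cV[R]_p) K :
  resid X (X *m beta) K = \sum_j beta j 0 *: resid X (col j X) K.
Proof.
rewrite residE mulmx_sum_colE mulmx_sumr; apply: eq_bigr => j _.
by rewrite -scalemxAr -residE.
Qed.

Lemma resid_supp (beta : 'cV[R]_p) : {subset supp beta <= J} ->
  resid X (X *m beta) J = 0.
Proof.
move=> bJ; rewrite resid_mulmx big1// => j _.
have [->|b0] := eqVneq (beta j 0) 0; first by rewrite scale0r.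
by rewrite resid_mem ?scaler0//; apply: bJ; rewrite inE.
Qed.

(** Otherwise X = P_J X, whose rank is at most the number of columns in [J]. *)
Lemma ex_resid_neq0 : (size J < \rank X)%N -> exists t, resid X (col t X) J != 0.
Proof.
move=> JX; apply/existsP; apply: contraT => /existsPn H; exfalso.
have : X = projJ X J *m X.
  apply/matrixP => i j; have /negPn := H j.
  rewrite /resid subr_eq0 => /eqP/(congr1 (fun M : 'cV_n => M i 0)).
  by rewrite !mxE => ->; apply: eq_bigr => k _; rewrite !mxE.
move/(congr1 (fun M => \rank M)) => e; move: JX; rewrite e ltnNge /projJ -mulmxA.
by rewrite (leq_trans (mxrankM_maxl _ _))// rank_leq_col.
Qed.

End full.

Lemma rank_subcols_le J : (\rank (subcols X J) <= \rank X)%N.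
Proof.
have -> : subcols X J = X *m subcols 1%:M J.
  by apply/matrixP => i j; rewrite -[in LHS](mulmx1 X) !mxE; apply: eq_bigr => k _; rewrite !mxE.
exact: mxrankM_maxl.
Qed.

(** * Consequences of the exact recovery condition *)

Section erc.
Variable I : {set 'I_p}.
Hypothesis erc : ERC X I.

Lemma erc_full_rank : full_rank (enum I).
Proof. by case: erc => /eqP. Qed.

Lemma erc_full_rank_subset J : uniq J -> {subset J <= I} -> full_rank J.
Proof.
move=> uJ JI; apply: full_rank_subset erc_full_rank => // t /JI.
by rewrite mem_enum.
Qed.

(* Tropp's argument: on the span of the columns in I, the correlation with an
   outer column is an l1-contraction of the correlations with the inner ones. *)
Lemma erc_corr s : resid X s (enum I) = 0 -> s != 0 ->
  exists2 t, t \in I &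
    0 < `|dotc (col t X) s| /\
    forall j, j \notin I -> `|dotc (col j X) s| < `|dotc (col t X) s|.
Proof.
move=> rs s0; have fI := erc_full_rank.
pose A := subcols X (enum I).
have AtE i : (A^T *m s) i 0 = dotc (col (tnth (in_tuple (enum I)) i) X) s.
  by rewrite -col_subcols /dotc -/A tr_col -row_mul [RHS]mxE.
(* If all inner correlations vanished, the projection of [s] on the span of I, which is [s] itself,
   would be zero. *)
have [t0 t0I ct0] : exists2 t, t \in I & dotc (col t X) s != 0.
  apply/exists_inP; apply: contraT => /exists_inPn H; exfalso.
  move/eqP: s0; apply; move/eqP: rs; rewrite subr_eq0 => /eqP ->.
  rewrite /projJ /Defs.pinv -!mulmxA (_ : _^T *m s = 0) ?mulmx0//.
  apply/colP => i; rewrite AtE [RHS]mxE; apply/eqP/negPn/H.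
  by rewrite -(mem_enum I); exact: (mem_tnth i (in_tuple (enum I))).
have [t tI tmax] := arg_maxP (fun t => `|dotc (col t X) s|) t0I.
have t_gt0 : 0 < `|dotc (col t X) s|.
  by apply: lt_le_trans (tmax _ t0I); rewrite normr_gt0.
exists t => //; split => // j jI.
have := erc.2 j jI; rewrite -/(subcolsS X I) => erc_j.
pose d := pinv A *m col j X.
(* As [s] equals its projection on the span of I, its correlation with column j is that of the
   projected column [A *m d]. *)
have -> : dotc (col j X) s = \sum_i d i 0 * (A^T *m s) i 0.
  transitivity (dotc (A *m d) s); last first.
    by rewrite /dotc trmx_mul -mulmxA mxE; apply: eq_bigr => i _; rewrite mxE.
  rewrite /d mulmxA; have := rs; rewrite /resid => /eqP; rewrite subr_eq0 => /eqP es.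
  by rewrite [in LHS]es /dotc trmx_mul -/(projJ X (enum I)) [(projJ _ _)^T]proj_sym mulmxA.
apply: le_lt_trans (ler_norm_sum _ _ _) _.
apply: (@le_lt_trans _ _ ((\sum_i `|d i 0|) * `|dotc (col t X) s|)).
  rewrite mulr_suml; apply: ler_sum => i _; rewrite normrM ler_wpM2l// AtE; apply: tmax.
  by have := mem_tnth i (in_tuple (enum I)); rewrite [_ \in _]mem_enum.
by rewrite -[ltRHS]mul1r ltr_pM2r.
Qed.

Variable beta : 'cV[R]_p.
Hypothesis suppE : supp beta = I.

(** Some i in I is missing from [J]. A zero residual would put X beta in the span of the columns in
    I other than i; as beta_i is nonzero, column i would lie there too, against the independence of
    the columns in I. *)
Lemma resid_signal_neq0 J : uniq J -> {subset J <= I} -> (size J < #|I|)%N ->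
  resid X (X *m beta) J != 0.
Proof.
move=> uJ JI sJ; apply/negP => /eqP r0.
have [i iI iJ] : exists2 i, i \in I & i \notin J.
  apply/exists_inP; apply: contraT => /exists_inPn H; exfalso.
  move: sJ; rewrite ltnNge cardE uniq_leq_size ?enum_uniq// => j.
  by rewrite mem_enum => /H/negPn.
pose K := rem i (enum I).
have pK : perm_eq (enum I) (rcons K i).
  by rewrite perm_sym perm_rcons perm_sym perm_to_rem// mem_enum.
have uK : uniq K by rewrite rem_uniq// enum_uniq.
have fK : full_rank K.
  apply: erc_full_rank_subset => // j /mem_rem; by rewrite mem_enum.
have /(full_rank_rcons _ fK) : full_rank (rcons K i).
  by rewrite -(full_rank_perm _ _ pK) erc_full_rank.
apply; have JK : {subset J <= K}.
  move=> j jJ; rewrite mem_rem_uniq ?enum_uniq// inE mem_enum JI// andbT.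
  by apply: contra iJ => /eqP <-.
have : resid X (X *m beta) K = 0.
  move/eqP: r0; rewrite subr_eq0 => /eqP ->; exact: resid_projJ.
rewrite resid_mulmx (bigD1 i)//= big1 => [/eqP|j ji].
  rewrite addr0 scaler_eq0 => /orP[|/eqP//].
  by move: iI; rewrite -suppE inE => /negbTE ->.
have [->|b0] := eqVneq (beta j 0) 0; first by rewrite scale0r.
rewrite resid_mem ?scaler0// mem_rem_uniq ?enum_uniq// inE ji mem_enum -suppE.
by rewrite inE.
Qed.

(** Both X beta and its projection lie in the span of the columns in I, so [erc_corr] applies to the
    noiseless residual. *)
Lemma resid_signal_span J : {subset J <= I} ->
  resid X (resid X (X *m beta) J) (enum I) = 0.
Proof.
move=> JI; rewrite {2}/resid residD resid_supp ?add0r; first last.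
- by move=> j; rewrite suppE mem_enum.
- exact: erc_full_rank.
rewrite -mulmxN resid_projJ//; first exact: erc_full_rank.
by move=> j /JI; rewrite mem_enum.
Qed.

End erc.
End residuals.

(** Each condition passes to smaller thresholds, so the minimum of finitely many works for all. *)
Lemma finite_uniform_pos (R : realType) (T : finType) (Q : T -> R -> Prop) :
  (forall t a b, a <= b -> Q t b -> Q t a) ->
  (forall t, exists2 a, 0 < a & Q t a) -> exists2 a, 0 < a & forall t, Q t a.
Proof.
move=> Qmono Qex.
suff [a a0 Ha] : exists2 a, 0 < a & forall t, t \in enum T -> Q t a.
  by exists a => // t; apply: Ha; rewrite mem_enum.
elim: (enum T) => [|t s [a a0 IH]]; first by exists 1.
have [b b0 Qb] := Qex t; exists (Num.min a b); first by rewrite lt_min a0.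
move=> u; rewrite inE => /orP[/eqP->|/IH].
  by apply: Qmono Qb; rewrite ge_min lexx orbT.
by apply: Qmono; rewrite ge_min lexx.
Qed.

(** * Iterates of OMP and the selected iteration *)

Section omp_theory.
Context {R : realType} {n p : nat}.
Variable X : 'M[R]_(n, p).
Variable t0 : 'I_p.
Implicit Types (J : seq 'I_p) (y w : 'cV[R]_n).

(** The index [t0] rules out the empty case of [pick]. Only maximality of the selection is retained,
    so later arguments hold for any tie-breaking. *)
Lemma omp_stepP y J : exists2 t, omp_step X y J = rcons J t &
  forall u, `|dotc (col u X) (resid X y J)| <= `|dotc (col t X) (resid X y J)|.
Proof.
rewrite /omp_step; case: pickP => [i _|/(_ t0)//].
by case: arg_maxP => // t _ tmax; exists t => // u; exact: tmax.
Qed.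

Lemma size_omp y k : size (omp X y k) = k.
Proof.
elim: k => //= k IH; have [t -> _] := omp_stepP y (omp X y k).
by rewrite size_rcons IH.
Qed.

Lemma take_omp y k m : (k <= m)%N -> take k (omp X y m) = omp X y k.
Proof.
elim: m => [|m IH]; first by rewrite leqn0 => /eqP->.
rewrite leq_eqVlt => /orP[/eqP->|]; first by rewrite take_oversize// size_omp.
rewrite ltnS => km; rewrite -(IH km) /=.
have [t -> _] := omp_stepP y (omp X y m).
by rewrite -cats1 takel_cat// size_omp.
Qed.

Lemma tf_kstar_unique y kmax k0 : (0 < k0 < kmax)%N ->
  (forall k, (0 < k < kmax)%N -> k != k0 -> tf_ratio X y k0 < tf_ratio X y k) ->
  tf_kstar X y kmax = k0.
Proof.
move=> /andP[k00 k0m] H.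
(* An element i of ['I_kmax.-1] stands for iteration i + 1. *)
have k0lt : (k0.-1 < kmax.-1)%N by rewrite -ltnS !prednK// (leq_trans _ k0m).
rewrite /tf_kstar; case: pickP => [i _|/(_ (Ordinal k0lt))//].
case: arg_minP => // j _ jmin; apply/eqP; apply: contraT => jk0.
have := jmin (Ordinal k0lt) isT; rewrite /= prednK// leNgt H//.
by rewrite ltn0Sn/= -ltn_predRL.
Qed.

(** * Deterministic recovery under small noise *)

Section recovery.
Variable beta : 'cV[R]_p.
Let I := supp beta.
Hypothesis erc : ERC X I.

(** [erc_corr] gives a strict gap for each [J]. Only finitely many [J] occur, encoded as sequences
    of bounded length, so one gap serves all. *)
Lemma erc_margin : exists2 eta, 0 < eta &
  forall J, uniq J -> {subset J <= I} -> (size J < #|I|)%N ->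
  exists t, let s := resid X (X *m beta) J in
    eta <= `|dotc (col t X) s| /\
    forall j, j \notin I -> `|dotc (col j X) s| + eta <= `|dotc (col t X) s|.
Proof.
pose Q (J : seq 'I_p) eta := uniq J -> {subset J <= I} -> (size J < #|I|)%N ->
  exists t, let s := resid X (X *m beta) J in
    eta <= `|dotc (col t X) s| /\
    forall j, j \notin I -> `|dotc (col j X) s| + eta <= `|dotc (col t X) s|.
suff [eta eta0 Heta] : exists2 eta, 0 < eta &
    forall J : {bseq #|I| of 'I_p}, Q J eta.
  exists eta => // J uJ JI sJ.
  exact: (Heta (Bseq (ltnW sJ)) uJ JI sJ).
apply: finite_uniform_pos => [J a b ab QJ uJ JI sJ|J].
  have [t [t1 t2]] := QJ uJ JI sJ; exists t; split; first exact: le_trans ab t1.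
  by move=> j /t2; apply: le_trans; rewrite lerD2l.
have [[uJ JI sJ]|nJ] := pselect [/\ uniq J, {subset J <= I} & (size J < #|I|)%N]; last first.
  by exists 1 => // uJ JI sJ; exfalso; apply: nJ.
have [t _ [t_gt0 tI]] := erc_corr _ _ erc _ (resid_signal_span X I erc beta erefl J JI)
  (resid_signal_neq0 X I erc beta erefl J uJ JI sJ).
set s := resid X _ J in t_gt0 tI.
have [a a0 Ha] : exists2 a, 0 < a & forall j : 'I_p, j \notin I ->
    `|dotc (col j X) s| + a <= `|dotc (col t X) s|.
  apply: finite_uniform_pos => [j a b ab H /H|j].
    by apply: le_trans; rewrite lerD2l.
  have [jI|jI] := boolP (j \in I); first by exists 1.
  exists (`|dotc (col t X) s| - `|dotc (col j X) s|); first by rewrite subr_gt0 tI.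
  by rewrite addrC subrK.
exists (Num.min a `|dotc (col t X) s|); first by rewrite lt_min a0.
move=> _ _ _; exists t; split; first by rewrite ge_min lexx orbT.
by move=> j /Ha; apply: le_trans; rewrite lerD2l ge_min lexx.
Qed.

Hypothesis unit_cols : forall j, sqnorm (col j X) = 1.
Hypothesis k0_gt0 : (0 < #|I|)%N.
Let y w := X *m beta + w.

Lemma omp_signal_phase : exists2 eta, 0 < eta & forall w, sqnorm w <= eta ->
  forall k, (k <= #|I|)%N ->
    [/\ uniq (omp X (y w) k), {subset omp X (y w) k <= I} &
      (k < #|I|)%N -> eta <= sqnorm (omp_resid X (y w) k)].
Proof.
have [eta eta0 Heta] := erc_margin.
exists ((eta / 4) ^+ 2); first by rewrite exprn_gt0// divr_gt0.
move=> w wle.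
have corr_w J t : full_rank X J -> `|dotc (col t X) (resid X w J)| <= eta / 4.
  move=> fJ; rewrite -(@ler_pXn2r _ 2)// ?nnegrE ?divr_ge0 ?(ltW eta0)//.
  rewrite real_normK ?num_real//.
  apply: (le_trans (dotc_unit_le _ _ (unit_cols t))).
  exact: le_trans (sqnorm_resid_le _ _ fJ _) wle.
have step J : uniq J -> {subset J <= I} -> (size J < #|I|)%N ->
    exists t, [/\ omp_step X (y w) J = rcons J t, t \in I, t \notin J &
      (eta / 4) ^+ 2 <= sqnorm (resid X (y w) J)].
  move=> uJ JI sJ; have fJ := erc_full_rank_subset _ _ erc _ uJ JI.
  have [u [u1 u2]] := Heta J uJ JI sJ.
  have [t tE tmax] := omp_stepP (y w) J.
  have cu := corr_w J u fJ; have ct := corr_w J t fJ.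
  have rE v : dotc (col v X) (resid X (y w) J) =
      dotc (col v X) (resid X (X *m beta) J) + dotc (col v X) (resid X w J).
    by rewrite residD dotcDr.
  have ru : 3 * (eta / 4) <= `|dotc (col u X) (resid X (y w) J)|.
    rewrite rE; have := lerB_normD (dotc (col u X) (resid X (X *m beta) J))
      (dotc (col u X) (resid X w J)); lra.
  exists t; split => //.
  - apply: contraT => tI; have := tmax u; rewrite !rE.
    have := lerB_normD (dotc (col u X) (resid X (X *m beta) J))
      (dotc (col u X) (resid X w J)).
    have := ler_normD (dotc (col t X) (resid X (X *m beta) J))
      (dotc (col t X) (resid X w J)).
    have := u2 _ tI; lra.
  - apply/negP => tJ; have := tmax u; rewrite (dotc_resid_mem _ _ fJ t _ tJ) normr0; lra.
  - apply: le_trans (dotc_unit_le _ _ (unit_cols u)).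
    rewrite -[leRHS]real_normK ?num_real// lerXn2r// ?nnegrE//; lra.
elim=> [|k IH] kI.
  split => // k0I; rewrite /omp_resid /=.
  by have [t []] := step [::] isT (fun _ => ltac:(done)) k0I.
have [uJ JI _] := IH (ltnW kI).
have [|t [tE tI tJ _]] := step _ uJ JI; first by rewrite size_omp.
have uJ' : uniq (omp X (y w) k.+1) by rewrite /= tE rcons_uniq tJ.
have JI' : {subset omp X (y w) k.+1 <= I}.
  by move=> j; rewrite /= tE mem_rcons inE => /orP[/eqP->//|/JI].
split => // kI'; have [|t' []//] := step _ uJ' JI'.
by rewrite size_omp.
Qed.

Lemma omp_noise_phase w (sel : seq 'I_p -> 'I_p) delta kmax : 0 < delta ->
  (forall J, full_rank X J -> (size J < kmax)%N ->
     delta * sqnorm w < dotc (resid X (col (sel J) X) J) w ^+ 2) ->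
  omp X (y w) #|I| =i I -> uniq (omp X (y w) #|I|) ->
  forall k, (#|I| <= k < kmax)%N ->
    delta * sqnorm w < sqnorm (omp_resid X (y w) k) <= sqnorm w.
Proof.
move=> d0 Hsel IE uI.
have resE J : full_rank X J -> {subset I <= J} -> resid X (y w) J = resid X w J.
  by move=> fJ IJ; rewrite residD resid_supp ?add0r.
have corr J : full_rank X J -> {subset I <= J} -> (size J < kmax)%N ->
    delta * sqnorm w < dotc (col (sel J) X) (resid X (y w) J) ^+ 2.
  by move=> fJ IJ sJ; rewrite resE// dotc_residC; exact: Hsel.
have inv k : (#|I| <= k < kmax)%N ->
    full_rank X (omp X (y w) k) /\ {subset I <= omp X (y w) k}.
  move=> /andP[]; elim: k => [|k IH].
    by rewrite leqn0 => /eqP e; move: k0_gt0; rewrite e.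
  rewrite leq_eqVlt => /orP[/eqP <- _|].
    split; last by move=> j jI; rewrite IE.
    by apply: (erc_full_rank_subset _ _ erc) => // j; rewrite IE.
  rewrite ltnS => Ik kk; have [fJ IJ] := IH Ik (ltnW kk).
  have [t tE tmax] := omp_stepP (y w) (omp X (y w) k).
  rewrite /= tE; split; last by move=> j /IJ jJ; rewrite mem_rcons inE jJ orbT.
  apply/(full_rank_rcons _ _ fJ) => rt0.
  have := tmax (sel (omp X (y w) k)); rewrite [dotc (col t X) _]dotc_residC rt0.
  rewrite [dotc 0 _]dotcC dotc0 normr0 normr_le0 => /eqP c0.
  have := corr _ fJ IJ; rewrite size_omp (ltnW kk) c0 expr0n/= => /(_ isT).
  by apply/negP; rewrite -leNgt mulr_ge0 ?sqnorm_ge0// ltW.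
move=> k kb; have [fJ IJ] := inv k kb; apply/andP; split.
  apply: lt_le_trans (dotc_unit_le _ _ (unit_cols (sel (omp X (y w) k)))).
  by apply: corr => //; rewrite size_omp; case/andP: kb.
by rewrite /omp_resid resE//; exact: sqnorm_resid_le.
Qed.

Lemma tf_omp_small_noise (sel : seq 'I_p -> 'I_p) kmax delta :
  (#|I| < kmax)%N -> 0 < delta ->
  exists2 eta, 0 < eta & forall w, sqnorm w <= eta ->
    (forall J, full_rank X J -> (size J < kmax)%N ->
       delta * sqnorm w < dotc (resid X (col (sel J) X) J) w ^+ 2) ->
    tf_omp X (y w) kmax = I.
Proof.
move=> Ikmax d0; have [c c0 Hc] := omp_signal_phase.
pose M := 2 * sqnorm (X *m beta) + 2.
have M0 : 0 < M by rewrite ltr_wpDl// mulr_ge0// sqnorm_ge0.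
pose eta := Num.min (Num.min 1 c) (c / 2 * Num.min delta (c / M)).
have eta0 : 0 < eta.
  by rewrite !lt_min ltr01 c0/= mulr_gt0 ?divr_gt0// lt_min d0 divr_gt0.
exists eta => // w weta Hsel.
have [w1 wc wmin] : [/\ sqnorm w <= 1, sqnorm w <= c &
    sqnorm w <= c / 2 * Num.min delta (c / M)].
  by move: weta; rewrite !le_min => /andP[/andP[-> ->] ->].
have {}wmin : sqnorm w < c * Num.min delta (c / M).
  apply: (le_lt_trans wmin); rewrite ltr_pM2r ?lt_min ?d0 ?divr_gt0//; lra.
have {}Hc := Hc w wc.
have [uI JI _] := Hc _ (leqnn _).
have IE : omp X (y w) #|I| =i I.
  move=> j; rewrite -[RHS]mem_enum.
  have [||_ ->//] := uniq_min_size uI (s2 := enum I).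
    by move=> i /JI; rewrite mem_enum.
  by rewrite size_omp -cardE.
have noise := omp_noise_phase w sel delta kmax d0 Hsel IE uI.
have ybound : sqnorm (y w) <= M.
  by apply: (le_trans (sqnormD_le _ _)); rewrite /M; lra.
have resid_ub k : (k <= #|I|)%N -> sqnorm (omp_resid X (y w) k) <= M.
  move=> kI; have [uJ kJI _] := Hc k kI.
  apply: le_trans ybound; apply: sqnorm_resid_le.
  exact: (erc_full_rank_subset _ _ erc).
have ratio_k0 : tf_ratio X (y w) #|I| < Num.min delta (c / M).
  have [_ _ /(_ _)] := Hc _ (leq_pred #|I|); rewrite prednK// => /(_ (leqnn _)) prev_ge.
  have prev_gt0 := lt_le_trans c0 prev_ge.
  rewrite /tf_ratio ltr_pdivrMr//.
  have /andP[_ /le_lt_trans] := noise #|I| (introT andP (conj (leqnn _) Ikmax)); apply.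
  apply: (lt_le_trans wmin); rewrite mulrC ler_wpM2l//.
  by rewrite le_min !ltW// divr_gt0.
have kstar : tf_kstar X (y w) kmax = #|I|.
  apply: tf_kstar_unique => [|k /andP[k0 kmaxk] kI]; first by rewrite k0_gt0.
  apply: (lt_le_trans ratio_k0); move: kI; rewrite neq_ltn => /orP[kI|Ik].
    have [_ _ /(_ kI) ck] := Hc k (ltnW kI).
    have k1I : (k.-1 < #|I|)%N by rewrite (leq_ltn_trans (leq_pred _)).
    have [_ _ /(_ k1I) ck1] := Hc _ (ltnW k1I).
    rewrite ge_min; apply/orP; right; apply: ler_pM => //; first exact: ltW.
      by rewrite invr_ge0 ltW.
    by rewrite lef_pV2 ?posrE// ?(lt_le_trans c0)//; exact/resid_ub/ltnW.
  have /andP[dk _] := noise k (introT andP (conj (ltnW Ik) kmaxk)).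
  have k1 : (#|I| <= k.-1 < kmax)%N.
    by rewrite (leq_ltn_trans (leq_pred _) kmaxk) andbT -ltnS prednK.
  have /andP[dk1 k1w] := noise _ k1.
  have k1_gt0 : 0 < sqnorm (omp_resid X (y w) k.-1).
    by apply: le_lt_trans dk1; rewrite mulr_ge0 ?sqnorm_ge0// ltW.
  rewrite ge_min; apply/orP; left; rewrite /tf_ratio ler_pdivlMr//.
  by apply: le_trans (ltW dk); rewrite ler_pM2l.
apply/setP => j; rewrite /tf_omp kstar take_omp ?(ltnW Ikmax)// inE; exact: IE.
Qed.

End recovery.
End omp_theory.

Lemma exists_gaussian_tail_le (R : realType) (c e : R) : 0 <= c -> 0 < e ->
  exists2 K : R, 0 <= K & c * (2 * expR (- (3 * K ^+ 2 / 8))) <= e.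
Proof.
move=> c0 e0; pose t := 2 * c / e; have t0 : 0 <= t by rewrite divr_ge0 ?mulr_ge0// ltW.
exists (Num.sqrt (8 / 3 * t)); first exact: sqrtr_ge0.
have -> : 3 * Num.sqrt (8 / 3 * t) ^+ 2 / 8 = t.
  by rewrite sqr_sqrtr; [field|apply: mulr_ge0 => //; lra].
rewrite expRN mulrA ler_pdivrMr ?expR_gt0//.
have : e * (1 + t) <= e * expR t by rewrite ler_pM2l// expR_ge1Dx.
have -> : e * (1 + t) = e + 2 * c by rewrite /t; field; rewrite gt_eqF.
lra.
Qed.

Lemma tf_omp_welldef_rank (R : realType) n p (X : 'M[R]_(n, p)) (t0 : 'I_p) y kmax :
  (0 < kmax)%N -> tf_omp_welldef X y kmax -> (kmax <= \rank X)%N.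
Proof.
case: kmax => // k _ /forallP/(_ ord_max)/andP[/eqP rk _].
by have := rank_subcols_le X (omp X y k.+1); rewrite rk (size_omp X t0).
Qed.

(* If no coordinate of w exceeds Ks while every relevant linear form exceeds as,
   then the forms are bounded below relative to |w|, as the deterministic
   recovery statement requires. *)
Lemma tf_omp_failure_le (R : realType) n p (X : 'M[R]_(n, p)) (beta : 'cV[R]_p) kmax :
  (forall j, sqnorm (col j X) = 1) -> (0 < #|supp beta|)%N ->
  ERC X (supp beta) -> (#|supp beta| < kmax)%N -> (kmax <= \rank X)%N ->
  forall e : R, 0 < e -> exists2 v0, 0 < v0 & forall v, 0 < v -> v <= v0 ->
    (gauss_prob (Num.sqrt v)
       (fun w => tf_omp X (X *m beta + w) kmax != supp beta) <= e%:E)%E.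
Proof.
move=> unitX I0 erc Ikmax kmaxX e e0.
have /card_gt0P[t0 _] := I0.
pose sel J := odflt t0 [pick t | resid X (col t X) J != 0].
have selP J : full_rank X J -> (size J < kmax)%N ->
    resid X (col (sel J) X) J != 0.
  move=> fJ sJ; rewrite /sel; case: pickP => //= nt.
  by have [t] := ex_resid_neq0 X J (leq_trans sJ kmaxX); rewrite nt.
pose P (J : {bseq kmax of 'I_p}) := full_rank X J && (size J < kmax)%N.
pose L (J : {bseq kmax of 'I_p}) i := resid X (col (sel J) X) J i 0.
have [|C C0 HC] := gauss_int_small_or_large n _ P L.
  move=> J /andP[fJ sJ]; apply: contrapT => nL; move/eqP: (selP J fJ sJ); apply.
  apply/colP => i; rewrite [RHS]mxE; apply/eqP; apply: contraT => Li.
  by exfalso; apply: nL; exists i.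
have [|K K0 HK] := exists_gaussian_tail_le _ n%:R (e / 2) (ler0n _ _).
  by rewrite divr_gt0.
pose a := e / (2 * (C + 1)).
have C1 : 0 < C + 1 by rewrite ltr_wpDl.
have a0 : 0 < a by rewrite divr_gt0// mulr_gt0.
have Ca : C * a <= e / 2.
  have -> : C * a = e / 2 * (C / (C + 1)) by rewrite /a; field; rewrite gt_eqF.
  by rewrite ler_piMr ?divr_ge0 ?(ltW e0)// ler_pdivrMr// mul1r lerDl.
pose N := n%:R * K ^+ 2.
have N0 : 0 <= N by rewrite mulr_ge0// sqr_ge0.
have N1 : 0 < N + 1 by rewrite ltr_wpDl.
have [|eta eta0 Heta] :=
  tf_omp_small_noise X t0 beta erc unitX I0 sel kmax (a ^+ 2 / (N + 1)) Ikmax.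
  by rewrite divr_gt0// exprn_gt0.
exists (eta / (N + 1)); first by rewrite divr_gt0.
move=> v v0 vle; set s := Num.sqrt v.
have s0 : 0 < s by rewrite sqrtr_gt0.
have s2 : s ^+ 2 = v by rewrite sqr_sqrtr// ltW.
apply: (@le_trans _ _ ((C * a + n%:R * (2 * expR (- (3 * K ^+ 2 / 8))))%:E)); last first.
  by rewrite lee_fin; lra.
apply: le_trans (HC s a K (fun=> 0) s0 (ltW a0) K0).
apply: le_gauss_int => z; rewrite lee_fin// ler_nat.
set w := \col_i z i; case: (boolP (_ || _)) => [_|]; first by rewrite leq_b1.
rewrite negb_or => /andP[/existsPn smallz /existsPn largez].
have wle : sqnorm w <= N * v.
  rewrite /sqnorm /N -s2 -mulrA -exprMn mulr_natl.
  rewrite -[X in _ *+ X]card_ord -sumr_const; apply: ler_sum => i _.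
  rewrite mxE -[leLHS]real_normK ?num_real// lerXn2r ?nnegrE ?mulr_ge0 ?(ltW s0)//.
  by have := largez i; rewrite -ltNge => /ltW.
rewrite leqn0 eqb0 negbK; apply/eqP; apply: Heta.
  apply: (le_trans wle); move: vle; rewrite ler_pdivlMr// => vle.
  by apply: le_trans vle; rewrite mulrC ler_pM2l// lerDl.
move=> J fJ sJ.
have := smallz (Bseq (ltnW sJ)); rewrite /P fJ sJ/= -ltNge add0r.
have -> : \sum_i L (Bseq (ltnW sJ)) i * z i = dotc (resid X (col (sel J) X) J) w.
  by rewrite dotcE; apply: eq_bigr => i _; rewrite [w _ _]mxE.
move=> as_lt; rewrite -[ltRHS]real_normK ?num_real//.
apply: (@le_lt_trans _ _ ((a * s) ^+ 2)); last first.
  by rewrite ltr_pXn2r// nnegrE mulr_ge0// ltW.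
rewrite [(a * s) ^+ 2]exprMn s2 -mulrA ler_pM2l ?exprn_gt0// mulrC ler_pdivrMr//.
by apply: (le_trans wle); rewrite mulrC ler_pM2l// lerDl.
Qed.

Theorem theorem2 (R : realType) (n p : nat) (X : 'M[R]_(n, p))
    (beta : 'cV[R]_p) (kmax : nat) :
  (forall j : 'I_p, \sum_i X i j ^+ 2 = 1) ->
  (1 <= #|supp beta|)%N ->
  ERC X (supp beta) ->
  (#|supp beta| < kmax)%N ->
  (* standing assumption of TF-OMP: holds almost surely for every noise level *)
  (forall v : R, 0 < v ->
     gauss_prob (Num.sqrt v)
       (fun w => ~~ tf_omp_welldef X (X *m beta + w) kmax) = 0%E) ->
  (fun v : R => gauss_prob (Num.sqrt v)
       (fun w => tf_omp X (X *m beta + w) kmax != supp beta))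
    @ (0 : R)^'+ --> 0%E.
Proof.
move=> unitX I0 erc Ikmax welldef.
have /card_gt0P[t0 _] := I0.
have [w0 /negPn wd0] := gauss_prob_eq0_ex _ _ _ (welldef 1 ltr01).
have kmaxX := tf_omp_welldef_rank _ _ _ X t0 _ _ (leq_trans (ltn0Sn _) Ikmax) wd0.
have colX j : sqnorm (col j X) = 1.
  by rewrite -(unitX j); apply: eq_bigr => i _; rewrite mxE.
have bound := tf_omp_failure_le _ _ _ X beta kmax colX I0 erc Ikmax kmaxX.
set F := fun v : R => _.
have F0 v : (0 <= F v)%E by apply: gauss_int_ge0 => z; rewrite lee_fin.
have Ffin v : F v \is a fin_num.
  rewrite ge0_fin_numE//; apply: le_lt_trans (ltry 1).
  exact: gauss_int_bool_le1.
apply/fine_cvgP; split; first exact: nearW.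
apply/cvgrPdist_le => e e0; have [v0 v00 Hv] := bound e e0.
near=> v; rewrite sub0r normrN ger0_norm ?fine_ge0//.
rewrite -lee_fin fineK//; apply: Hv; first by near: v; exact: nbhs_right_gt.
by near: v; exact: nbhs_right_le.
Unshelve. all: by end_near.
Qed.
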